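(* Assuming continuity in time (so that $\boldsymbol{w}\cdot\partial_t\boldsymbol{y}=\partial_t(\rho e_t)$ by the chain rule at the quadrature points), the corrected pressure-based DG semi-discretization on an element $\kappa$, $$\sum_{j=1}^{n_b}\mathcal{M}_{kj}\frac{d\widehat{\boldsymbol{y}}_j}{dt}+\boldsymbol{\mathcal{R}}_k=0,\qquad \boldsymbol{\mathcal{R}}_k=\widetilde{\boldsymbol{\mathcal{R}}}_k+\boldsymbol{r}_k,\qquad \boldsymbol{r}_k=\alpha(\widehat{\boldsymbol{w}}_k-\overline{\boldsymbol{w}}),\qquad k=1,\dots,n_b,$$ satisfies $$\boldsymbol{1}^T\boldsymbol{W}\,\frac{d\,\rho e_t(\boldsymbol{y}_q)}{dt}+\oint_{\partial\kappa}\mathcal{F}^\dagger_{\rho e_t}(\boldsymbol{y}^+,\boldsymbol{y}^-,\boldsymbol{n})\,ds=0,$$ where $\boldsymbol{1}^T\boldsymbol{W}\frac{d\rho e_t(\boldsymbol{y}_q)}{dt}=\sum_{i=1}^{n_q}\omega_{q,i}\,\partial_t(\rho e_t)(\boldsymbol{x}_{q,i})$. This is an approximation, subject solely to the quadrature error associated with the first term, of the statement of local conservation of total energy $\int_\kappa\partial_t(\rho e_t)\,dx+\oint_{\partial\kappa}\mathcal{F}^\dagger_{\rho e_t}(\boldsymbol{y}^+,\boldsymbol{y}^-,\boldsymbol{n})\,ds=0$.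
   Context: State: $\boldsymbol{y}=(\rho v_1,\dots,\rho v_d,P,C_1,\dots,C_{n_s})^T\in\mathbb{R}^m$, with $\boldsymbol{v}$ velocity, $P$ pressure, $C_i$ molar concentrations, $W_i$ molar masses, $\rho=\sum_iW_iC_i>0$. Mixture of thermally perfect gases: $P=R^0T\sum_iC_i$, with $R^0$ the universal gas constant, $\rho u=\sum_iW_iC_iu_i(T)$, $u_i(T)=h_{\mathrm{ref},i}+\int_{T_{\mathrm{ref}}}^Tc_{p,i}(\tau)d\tau-(R^0/W_i)T$ with $c_{p,i}$ polynomial in temperature, total energy $\rho e_t=\rho u+\frac12\rho\,\boldsymbol{v}\cdot\boldsymbol{v}$, viewed as a function of $\boldsymbol{y}$; $\rho c_v=\sum_iW_iC_i(c_{p,i}-R^0/W_i)$; $c$ is the speed of sound, $c^2=\gamma P/\rho$ with $\gamma$ the mixture specific heat ratio. Uncorrected residual: with $\boldsymbol{y}=\sum_{j=1}^{n_b}\widehat{\boldsymbol{y}}_j\phi_j$ on $\kappa$ ($\{\phi_j\}$ a basis of $\mathcal{P}_p(\kappa)$, the polynomials of degree at most $p$) and mass matrix $\mathcal{M}_{ij}=\int_\kappa\phi_i\phi_jdx$, $$\widetilde{\boldsymbol{\mathcal{R}}}_k=\oint_{\partial\kappa}\phi_k\boldsymbol{\mathcal{F}}^\dagger ds-\int_\kappa\nabla\phi_k\cdot\boldsymbol{\mathcal{F}}(\boldsymbol{y})dx+\oint_{\partial\kappa}\phi_k\boldsymbol{\mathcal{D}}\,ds+\int_\kappa\phi_k\,\boldsymbol{\mathcal{B}}(\boldsymbol{y}):\nabla\boldsymbol{y}\,dx\in\mathbb{R}^m.$$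 Here $\boldsymbol{\mathcal{F}}_k(\boldsymbol{y})=(\rho v_kv_1+P\delta_{k1},\dots,\rho v_kv_d+P\delta_{kd},Pv_k,v_kC_1,\dots,v_kC_{n_s})^T$ is the $k$th spatial flux component; $\boldsymbol{\mathcal{F}}^\dagger=\tfrac12(\boldsymbol{\mathcal{F}}(\boldsymbol{y}^+)+\boldsymbol{\mathcal{F}}(\boldsymbol{y}^-))\cdot\boldsymbol{n}+\tfrac12\lambda(\boldsymbol{y}^+-\boldsymbol{y}^-)$ ($\lambda$ a wave speed estimate, $\boldsymbol{n}$ outward normal, $\boldsymbol{y}^+$ interior trace, $\boldsymbol{y}^-$ neighbor trace; all faces interior); $\boldsymbol{\mathcal{B}}(\boldsymbol{y}):\nabla\boldsymbol{y}$ has only a nonzero pressure component, $\boldsymbol{\mathcal{B}}_P(\boldsymbol{y}):\nabla\boldsymbol{y}=(\rho c^2-P)\nabla\cdot\boldsymbol{v}$, with $\boldsymbol{\mathcal{B}}_{P,k}=\frac{\rho c^2-P}{\rho}(\delta_{k1},\dots,\delta_{kd},0,-W_1v_k,\dots,-W_{n_s}v_k)^T$; $\boldsymbol{\mathcal{D}}$ has only a nonzero pressure component $\mathcal{D}_P=\tfrac12(\boldsymbol{\mathcal{B}}_P\cdot\boldsymbol{n})|_{(\boldsymbol{y}^++\boldsymbol{y}^-)/2}\cdot(\boldsymbol{y}^--\boldsymbol{y}^+)$. Quadrature and projection: $\{\boldsymbol{x}_{q,i}\},\{\omega_{q,i}\}$, $i=1,\dots,n_q$, are points and weights of a quadrature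 rule on $\kappa$ (Jacobian absorbed in the weights); $\boldsymbol{W}=\mathrm{diag}(\omega_{q,1},\dots,\omega_{q,n_q})$; $\boldsymbol{1}$ is the vector of ones; $(V_q)_{ij}=\phi_j(\boldsymbol{x}_{q,i})$; $\boldsymbol{y}_q=\boldsymbol{V}_q\widehat{\boldsymbol{y}}$ are the values of $\boldsymbol{y}$ at the quadrature points. Let $$\boldsymbol{w}=\frac{\partial(\rho e_t)}{\partial\boldsymbol{y}}=\Big(v_1,\dots,v_d,\ \tfrac{\rho c_v}{R^0\sum_jC_j},\ \big(W_iu_i-\tfrac{\rho c_vP}{R^0(\sum_jC_j)^2}-\tfrac{W_i}{2}\boldsymbol{v}\cdot\boldsymbol{v}\big)_{i=1}^{n_s}\Big)^T,$$ $\boldsymbol{w}_q=\boldsymbol{w}(\boldsymbol{y}_q)$ and $\widehat{\boldsymbol{w}}=\mathcal{M}^{-1}\boldsymbol{V}_q^T\boldsymbol{W}\boldsymbol{w}_q$ (coefficients $\widehat{\boldsymbol{w}}_k\in\mathbb{R}^m$, $k=1,\dots,n_b$, matrices acting on each of the $m$ components), $\overline{\boldsymbol{w}}=\frac1{n_b}\sum_k\widehat{\boldsymbol{w}}_k$. Total-energy numerical flux: $\mathcal{F}^\dagger_{\rho e_t}=\tfrac12\big(\boldsymbol{\mathcal{F}}_{\rho e_t}(\boldsymbol{y}^+)+\boldsymbol{\mathcal{F}}_{\rho e_t}(\boldsymbol{y}^-)\big)\cdot\boldsymbol{n}+\tfrac12\lambda\big((\rho e_t)^+-(\rho e_t)^-\big)$,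 $\boldsymbol{\mathcal{F}}_{\rho e_t}(\boldsymbol{y})=\boldsymbol{v}(\rho e_t+P)$. The scalar $\alpha$ is determined by the constraint $\sum_{k=1}^{n_b}\widehat{\boldsymbol{w}}_k^T\boldsymbol{\mathcal{R}}_k=\oint_{\partial\kappa}\mathcal{F}^\dagger_{\rho e_t}ds$, i.e. $$\alpha=\frac{\oint_{\partial\kappa}\mathcal{F}^\dagger_{\rho e_t}ds-\sum_k\widehat{\boldsymbol{w}}_k^T\widetilde{\boldsymbol{\mathcal{R}}}_k}{\sum_k(\widehat{\boldsymbol{w}}_k-\overline{\boldsymbol{w}})^T(\widehat{\boldsymbol{w}}_k-\overline{\boldsymbol{w}})},$$ the denominator being assumed nonzero (it vanishes only if all $\widehat{\boldsymbol{w}}_k$ coincide). The face and volume integrals in $\widetilde{\boldsymbol{\mathcal{R}}}_k$ and $\oint\mathcal{F}^\dagger_{\rho e_t}ds$ may be evaluated with any fixed numerical integration. *)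

(* Defs.v *)
From HB Require Import structures.
From mathcomp Require Import all_boot all_order all_algebra.
From mathcomp Require Import all_classical all_reals all_analysis.
From mathcomp Require Import ring.

Set Implicit Arguments.
Unset Strict Implicit.
Unset Printing Implicit Defensive.

Import Order.TTheory GRing.Theory Num.Theory.
Import numFieldNormedType.Exports.

Local Open Scope classical_set_scope.
Local Open Scope ring_scope.

Definition dot (R : realType) (n : nat) (u v : 'rV[R]_n) : R :=
  \sum_(i < n) u 0 i * v 0 i.

(* State vectors y = (rho v_1, .., rho v_d, P, C_1, .., C_ns), m = d + 1 + ns. *)
Section State.
Variables (R : realType) (d ns : nat).

Definition mkstate (a : 'rV[R]_d) (b : R) (c : 'rV[R]_ns) : 'rV[R]_(d + 1 + ns) :=
  row_mx (row_mx a (const_mx b)) c.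

Definition momentum (y : 'rV[R]_(d + 1 + ns)) : 'rV[R]_d := lsubmx (lsubmx y).
Definition pressure (y : 'rV[R]_(d + 1 + ns)) : R := rsubmx (lsubmx y) 0 0.
Definition conc (y : 'rV[R]_(d + 1 + ns)) : 'rV[R]_ns := rsubmx y.
Definition csum (y : 'rV[R]_(d + 1 + ns)) : R := \sum_(i < ns) conc y 0 i.

End State.

(* At least one of the two intervals is empty or reduced to a point. *)
Definition oriented_integral (R : realType) (f : R -> R) (a b : R) : R :=
  \int[lebesgue_measure]_(x in `[a, b]) f x -
  \int[lebesgue_measure]_(x in `[b, a]) f x.

Record gas_mixture (R : realType) (ns : nat) := GasMixture {
  Rgas : R;
  molar_mass : 'I_ns -> R;
  href : 'I_ns -> R;
  Tref : R;
  cp : 'I_ns -> {poly R};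
  Rgas_gt0 : 0 < Rgas;
  molar_mass_gt0 : forall i, 0 < molar_mass i }.

Section Thermo.
Variables (R : realType) (d ns : nat) (g : gas_mixture R ns).
Local Notation W := (molar_mass g).
Local Notation R0 := (Rgas g).
Local Notation state := 'rV[R]_(d + 1 + ns).
Implicit Types y : state.

Definition density y : R := \sum_(i < ns) W i * conc y 0 i.
Definition velocity y : 'rV[R]_d := (density y)^-1 *: momentum y.
Definition temperature y : R := pressure y / (R0 * csum y).

(* The conditions under which v and T are defined. *)
Definition admissible y : Prop := 0 < density y /\ csum y != 0.

Definition species_energy (i : 'I_ns) (T : R) : R :=
  href g i + oriented_integral (fun s => (cp g i).[s]) (Tref g) T - R0 / W i * T.

Definition internal_energy y : R :=
  \sum_(i < ns) W i * conc y 0 i * species_energy i (temperature y).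

Definition total_energy y : R :=
  internal_energy y + 2^-1 * density y * dot (velocity y) (velocity y).

Definition rho_cp y : R :=
  \sum_(i < ns) W i * conc y 0 i * (cp g i).[temperature y].
Definition rho_cv y : R :=
  \sum_(i < ns) W i * conc y 0 i * ((cp g i).[temperature y] - R0 / W i).

(* c^2 = gamma P / rho with gamma = c_p / c_v. *)
Definition sound_speed_sqr y : R :=
  rho_cp y / rho_cv y * pressure y / density y.

(* w = d(rho e_t)/dy; closed form in [energy_gradientE]. *)
Definition energy_gradient y : state :=
  \row_(j < d + 1 + ns) 'D_(delta_mx 0 j) total_energy y.

Definition energy_gradient_formula y : state :=
  mkstate (velocity y)
    (rho_cv y / (R0 * csum y))
    (\row_(i < ns)
       (W i * species_energy i (temperature y)
        - rho_cv y * pressure y / (R0 * csum y ^+ 2)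
        - W i / 2 * dot (velocity y) (velocity y))).

Definition flux y (k : 'I_d) : state :=
  mkstate
    (\row_(j < d) (density y * velocity y 0 k * velocity y 0 j
                   + pressure y * (k == j)%:R))
    (pressure y * velocity y 0 k)
    (velocity y 0 k *: conc y).

Definition normal_flux y (n : 'rV[R]_d) : state := \sum_(k < d) n 0 k *: flux y k.

Definition numerical_flux (lam : R) (yp ym : state) (n : 'rV[R]_d) : state :=
  2^-1 *: (normal_flux yp n + normal_flux ym n) + (2^-1 * lam) *: (yp - ym).

Definition energy_flux y : 'rV[R]_d :=
  (total_energy y + pressure y) *: velocity y.

Definition numerical_energy_flux (lam : R) (yp ym : state) (n : 'rV[R]_d) : R :=
  2^-1 * dot (energy_flux yp + energy_flux ym) n
  + 2^-1 * lam * (total_energy yp - total_energy ym).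

Definition BP y (k : 'I_d) : state :=
  ((density y * sound_speed_sqr y - pressure y) / density y) *:
    mkstate (delta_mx 0 k) 0 (\row_(i < ns) - (W i * velocity y 0 k)).

(* B(y) : grad y at x, for a state field y; see [nonconservativeE]. *)
Definition nonconservative (y : 'rV[R]_d -> state) (x : 'rV[R]_d) : state :=
  mkstate 0 (\sum_(k < d) dot (BP (y x) k) ('D_(delta_mx 0 k) y x)) 0.

Definition nonconservative_jump (yp ym : state) (n : 'rV[R]_d) : state :=
  mkstate 0
    (2^-1 * dot (\sum_(k < d) n 0 k *: BP (2^-1 *: (yp + ym)) k) (ym - yp))
    0.

End Thermo.

Section EnergyGradient.
Variable R : realType.

Let primitive (q : {poly R}) : {poly R} :=
  \poly_(i < (size q).+1) (q`_i.-1 / i%:R).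

Let deriv_primitive (q : {poly R}) : (primitive q)^`() = q.
Proof.
apply/polyP => i; rewrite coef_deriv coef_poly ltnS.
case: ltnP => [_|qi]; last by rewrite mul0rn nth_default.
by rewrite -[LHS]mulr_natr mulfVK // pnatr_eq0.
Qed.

Let integral_horner (q : {poly R}) (a b : R) : a < b ->
  \int[lebesgue_measure]_(x in `[a, b]) q.[x]
  = (primitive q).[b] - (primitive q).[a].
Proof.
move=> ab; rewrite /Rintegral.
rewrite (@continuous_FTC2 _ (horner q) (horner (primitive q)) a b ab) //.
- by apply: continuous_subspaceT; exact: continuous_horner.
- split=> [x _||]; first exact: derivable_horner.
  + by apply: cvg_at_right_filter; exact: continuous_horner.
  + by apply: cvg_at_left_filter; exact: continuous_horner.
- by move=> x _; rewrite -derivE deriv_primitive.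
Qed.

Lemma oriented_integral_horner (q : {poly R}) (a b : R) :
  oriented_integral (fun x => q.[x]) a b
  = (primitive q).[b] - (primitive q).[a].
Proof.
have int0 (x y : R) : y < x ->
    \int[lebesgue_measure]_(z in `[x, y]) q.[z] = 0.
  by move=> yx; rewrite set_itv_ge ?Rintegral_set0 // bnd_simp -ltNge.
rewrite /oriented_integral; case: (ltgtP a b) => [ab|ba|->].
- by rewrite (int0 _ _ ab) subr0 integral_horner.
- by rewrite (int0 _ _ ba) sub0r integral_horner // opprB.
- by rewrite !subrr.
Qed.

Let is_derive_ext (f h : R -> R) (t df : R) :
  (forall s, f s = h s) -> is_derive t 1 h df -> is_derive t 1 f df.
Proof. by move=> /funext ->. Qed.

Let is_derive_sumf n (h : 'I_n -> R -> R) (t : R) (dh : 'I_n -> R) :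
  (forall i, is_derive t 1 (h i) (dh i)) ->
  is_derive t 1 (fun s => \sum_(i < n) h i s) (\sum_(i < n) dh i).
Proof.
move=> H; have Hs := is_derive_sum H; apply: is_derive_ext Hs.
by move=> s; rewrite fct_sumE.
Qed.

Let is_deriveMf (f h : R -> R) (t df dh : R) :
  is_derive t 1 f df -> is_derive t 1 h dh ->
  is_derive t 1 (fun s => f s * h s) (df * h t + f t * dh).
Proof.
move=> Hf Hh; apply: (@is_derive_ext _ (f * h)) => //.
apply: is_derive_eq; rewrite /GRing.scale /= addrC; ring.
Qed.

Let is_deriveDf (f h : R -> R) (t df dh : R) :
  is_derive t 1 f df -> is_derive t 1 h dh ->
  is_derive t 1 (fun s => f s + h s) (df + dh).
Proof. by move=> Hf Hh; apply: (@is_derive_ext _ (f + h)). Qed.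

Let is_deriveZf (f : R -> R) (c t df : R) :
  is_derive t 1 f df -> is_derive t 1 (fun s => c * f s) (c * df).
Proof. by move=> Hf; apply: (@is_derive_ext _ (c *: f)). Qed.

Let is_derive_affine (c e t : R) : is_derive t 1 (fun s : R => c + e * s) e.
Proof.
have H := is_deriveDf (is_derive_cst c t 1) (is_deriveZf e (is_derive_id t 1)).
by apply: is_derive_eq; rewrite add0r mulr1.
Qed.

Variables (d ns : nat) (g : gas_mixture R ns).
Local Notation state := 'rV[R]_(d + 1 + ns).
Local Notation W := (molar_mass g).

Lemma is_derive_species_energy (i : 'I_ns) (T : R) :
  is_derive T 1 (species_energy g i) ((cp g i).[T] - Rgas g / W i).
Proof.
apply: (@is_derive_ext _ (fun s => (primitive (cp g i)).[s]
  + ((href g i - (primitive (cp g i)).[Tref g]) + (- (Rgas g / W i)) * s))).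
  by move=> s; rewrite /species_energy oriented_integral_horner; ring.
have Hp := is_derive_poly (primitive (cp g i)) T.
rewrite deriv_primitive in Hp.
exact: is_deriveDf Hp (is_derive_affine _ _ _).
Qed.

Let dot_mkstate (a : 'rV[R]_d) (b : R) (c : 'rV[R]_ns) (y : state) :
  dot (mkstate a b c) y
  = dot a (momentum y) + b * pressure y + dot c (conc y).
Proof.
rewrite /dot /mkstate big_split_ord /= big_split_ord /= big_ord1.
congr (_ + _ + _).
- by apply: eq_bigr => k _; rewrite !row_mxEl !mxE.
- by rewrite row_mxEl row_mxEr /pressure !mxE.
- by apply: eq_bigr => i _; rewrite !row_mxEr !mxE.
Qed.

Let kinetic_energyE (y : state) :
  density g y * dot (velocity g y) (velocity g y)
  = (density g y)^-1 * \sum_(k < d) momentum y 0 k * momentum y 0 k.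
Proof.
rewrite /dot mulr_sumr [RHS]mulr_sumr; apply: eq_bigr => k _.
set r := density g y.
have -> : velocity g y 0 k = r^-1 * momentum y 0 k by rewrite /velocity [LHS]mxE.
have [->|r0] := eqVneq r 0; first by rewrite invr0 !mul0r.
by rewrite -[RHS]mulr1 -(mulfV r0); ring.
Qed.

(* Chain rule along a differentiable path of states. *)
Lemma is_derive_total_energy (Y : R -> state) (t : R) (dY : state) :
  density g (Y t) != 0 -> csum (Y t) != 0 ->
  (forall j, is_derive t 1 (fun s => Y s 0 j) (dY 0 j)) ->
  is_derive t 1 (fun s => total_energy g (Y s))
    (dot (energy_gradient_formula g (Y t)) dY).
Proof.
move=> rho0 S0 HY.
have Rg0 : Rgas g != 0 by rewrite gt_eqF // Rgas_gt0.
have Hm k : is_derive t 1 (fun s => momentum (Y s) 0 k) (momentum dY 0 k).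
  by apply: (@is_derive_ext _ (fun s => Y s 0 (lshift ns (lshift 1 k)))) => [s|];
     rewrite !mxE.
have HP : is_derive t 1 (fun s => pressure (Y s)) (pressure dY).
  by apply: (@is_derive_ext _ (fun s => Y s 0 (lshift ns (rshift d 0)))) => [s|];
     rewrite /pressure !mxE.
have HC i : is_derive t 1 (fun s => conc (Y s) 0 i) (conc dY 0 i).
  by apply: (@is_derive_ext _ (fun s => Y s 0 (rshift (d + 1) i))) => [s|];
     rewrite !mxE.
have HS : is_derive t 1 (fun s => csum (Y s)) (csum dY) by exact: is_derive_sumf.
have Hr : is_derive t 1 (fun s => density g (Y s)) (density g dY).
  by apply: is_derive_sumf => i; exact: is_deriveZf.
pose dT := pressure dY / (Rgas g * csum (Y t))
           - pressure (Y t) * csum dY / (Rgas g * csum (Y t) ^+ 2).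
have HT : is_derive t 1 (fun s => temperature g (Y s)) dT.
  have RS0 : Rgas g * csum (Y t) != 0 by rewrite mulf_neq0.
  have H := is_deriveMf HP (@is_deriveV R (fun s => Rgas g * csum (Y s)) _ _ _ RS0 (is_deriveZf (Rgas g) HS)).
  apply: (is_derive_eq H); rewrite /dT /GRing.scale /=; field; exact/andP.
have HI : is_derive t 1 (fun s => internal_energy g (Y s))
    (\sum_(i < ns) (W i * conc dY 0 i * species_energy g i (temperature g (Y t))
      + W i * conc (Y t) 0 i
        * (((cp g i).[temperature g (Y t)] - Rgas g / W i) * dT))).
  apply: is_derive_sumf => i; apply: (is_deriveMf (is_deriveZf (W i) (HC i))).
  exact: (is_derive1_comp (is_derive_species_energy i _) HT).
pose M := \sum_(k < d) momentum (Y t) 0 k * momentum (Y t) 0 k.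
have HK : is_derive t 1
    (fun s => 2^-1 * density g (Y s) * dot (velocity g (Y s)) (velocity g (Y s)))
    (2^-1 * (- density g (Y t) ^- 2 * density g dY * M
      + (density g (Y t))^-1 *
        \sum_(k < d) (momentum dY 0 k * momentum (Y t) 0 k
                      + momentum (Y t) 0 k * momentum dY 0 k))).
  apply: (@is_derive_ext _ (fun s => 2^-1 * ((density g (Y s))^-1
      * \sum_(k < d) momentum (Y s) 0 k * momentum (Y s) 0 k))).
    by move=> s; rewrite -mulrA kinetic_energyE.
  apply: is_deriveZf; apply: (is_deriveMf (@is_deriveV R (fun s => density g (Y s)) _ _ _ rho0 Hr)).
  by apply: is_derive_sumf => k; exact: is_deriveMf (Hm k) (Hm k).
apply: (is_derive_eq (is_deriveDf HI HK)).
rewrite dot_mkstate.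
have -> : \sum_(k < d) (momentum dY 0 k * momentum (Y t) 0 k
            + momentum (Y t) 0 k * momentum dY 0 k)
          = 2 * (density g (Y t) * dot (velocity g (Y t)) (momentum dY)).
  rewrite /dot !mulr_sumr; apply: eq_bigr => k _.
  have -> : velocity g (Y t) 0 k = (density g (Y t))^-1 * momentum (Y t) 0 k.
    by rewrite /velocity [LHS]mxE.
  have H a b : density g (Y t) * ((density g (Y t))^-1 * a * b) = a * b.
    by rewrite -mulrA mulVKf.
  by rewrite H; ring.
have -> : M = density g (Y t) ^+ 2 * dot (velocity g (Y t)) (velocity g (Y t)).
  by rewrite expr2 -mulrA kinetic_energyE mulrA mulfV ?mul1r.
rewrite big_split /=.
have -> : \sum_(i < ns) W i * conc (Y t) 0 i
        * (((cp g i).[temperature g (Y t)] - Rgas g / W i) * dT)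
     = rho_cv g (Y t) * dT.
  by rewrite mulr_suml; apply: eq_bigr => i _; rewrite mulrA.
move: (dot (velocity g (Y t)) (velocity g (Y t))) => V.
have -> : dot (\row_i (W i * species_energy g i (temperature g (Y t))
       - rho_cv g (Y t) * pressure (Y t) / (Rgas g * csum (Y t) ^+ 2)
       - W i / 2 * V)) (conc dY)
   = (\sum_(i < ns) W i * conc dY 0 i * species_energy g i (temperature g (Y t)))
     - rho_cv g (Y t) * pressure (Y t) / (Rgas g * csum (Y t) ^+ 2) * csum dY
     - 2^-1 * V * density g dY.
  rewrite [dot _ (conc _)]/dot [csum dY]/csum [density g dY]/density.
  rewrite !mulr_sumr -!sumrB; apply: eq_bigr => i _.
  rewrite [X in X * _]mxE; move: (conc dY 0 i) => q.
  by ring.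
rewrite /dT; field.
by rewrite rho0 S0 Rg0.
Qed.

Lemma energy_gradientE (y : state) :
  density g y != 0 -> csum y != 0 ->
  energy_gradient g y = energy_gradient_formula g y.
Proof.
move=> rho0 S0; apply/rowP => j; rewrite mxE.
pose Y (s : R) : state := s *: delta_mx 0 j + y.
have Y0 : Y 0 = y by rewrite /Y scale0r add0r.
have HY i : is_derive (0 : R) 1 (fun s => Y s 0 i) ((delta_mx 0 j : state) 0 i).
  apply: (@is_derive_ext _ (fun s => y 0 i + (delta_mx 0 j : state) 0 i * s)).
    by move=> s; rewrite /Y !mxE mulrC addrC.
  exact: is_derive_affine.
have := @is_derive_total_energy Y 0 (delta_mx 0 j); rewrite Y0.
move=> /(_ rho0 S0 HY) [_ HD].
transitivity ('D_1 (fun s => total_energy g (Y s)) 0).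
  rewrite /derive; set f := fun h : R => _; set f' := fun h : R => _.
  suff -> : f = f' by [].
  by apply/funext => h; rewrite /f /f' /= Y0 addr0 /Y [h *: 1]mulr1.
rewrite HD /dot (bigD1 j) //= big1 ?addr0; last first.
  by move=> i ij; rewrite [delta_mx _ _ _ _]mxE (negbTE ij) andbF mulr0.
by rewrite [delta_mx _ _ _ _]mxE !eqxx mulr1.
Qed.

(* B(y) : grad y = (rho c^2 - P) div v. *)
Lemma nonconservativeE (y : 'rV[R]_d -> state) (x : 'rV[R]_d) :
  density g (y x) != 0 ->
  (forall k : 'I_d, derivable y x (delta_mx 0 k)) ->
  nonconservative g y x
  = mkstate 0 ((density g (y x) * sound_speed_sqr g (y x) - pressure (y x))
               * \sum_(k < d) 'D_(delta_mx 0 k) (fun z => velocity g (y z) 0 k) x)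
      0.
Proof.
move=> rho0 Hy; congr (mkstate _ _ _); rewrite mulr_sumr; apply: eq_bigr => k _.
set e : 'rV[R]_d := delta_mx 0 k; set dy := 'D_e y x.
have Hc j : is_derive x e (fun z => y z 0 j) (dy 0 j).
  apply: DeriveDef; first by move/derivable_mxP: (Hy k); exact.
  rewrite /dy derive_mx; last exact: Hy.
  have H := @mxE R 1 _ matrix_key (fun i j0 => 'D_e (fun z => y z i j0 : R) x) 0 j.
  by rewrite -[LHS]H.

have Hm : is_derive x e (fun z => momentum (y z) 0 k) (momentum dy 0 k).
  have -> : (fun z => momentum (y z) 0 k) = fun z => y z 0 (lshift ns (lshift 1 k)).
    by apply: funext => z; rewrite !mxE.
  by rewrite !mxE; exact: Hc.
have Hr : is_derive x e (fun z => density g (y z)) (density g dy).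
  have H i : is_derive x e (W i *: (fun z => y z 0 (rshift (d + 1) i)))
      (W i * conc dy 0 i).
    by rewrite mxE; apply: is_deriveZ.
  have := is_derive_sum H; congr (is_derive _ _ _ _).
  apply: funext => z; rewrite fct_sumE; apply: eq_bigr => i _.
  by rewrite [conc _ _ _]mxE.
have -> : 'D_e (fun z => velocity g (y z) 0 k) x
  = (density g (y x))^-1 * momentum dy 0 k
    - momentum (y x) 0 k * density g dy / density g (y x) ^+ 2.
  have -> : (fun z => velocity g (y z) 0 k)
      = (fun z => (density g (y z))^-1) * (fun z => momentum (y z) 0 k).
    by apply: funext => z; rewrite [LHS]mxE.
  have [dr Dr] := Hr; have [dm Dm] := Hm.
  rewrite deriveM //; last exact: derivableV.
  rewrite deriveV // Dr Dm /GRing.scale /=; field; exact: rho0.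
have -> : dot (BP g (y x) k) dy
  = (density g (y x) * sound_speed_sqr g (y x) - pressure (y x)) / density g (y x)
    * (momentum dy 0 k - velocity g (y x) 0 k * density g dy).
  rewrite {1}/dot /BP; under eq_bigr do rewrite [X in X * _]mxE -mulrA.
  rewrite -mulr_sumr; congr (_ * _).
  rewrite -/(dot _ _) dot_mkstate mul0r addr0 /dot; congr (_ + _).
    rewrite (bigD1 k) //= big1 ?addr0 => [|i ik].
      by rewrite [delta_mx _ _ _ _]mxE !eqxx mul1r.
    by rewrite [delta_mx _ _ _ _]mxE (negbTE ik) andbF mul0r.
  rewrite /density mulr_sumr -sumrN; apply: eq_bigr => i _.
  by rewrite [X in X * _]mxE; ring.
have -> : velocity g (y x) 0 k = (density g (y x))^-1 * momentum (y x) 0 k.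
  by rewrite [LHS]mxE.
by field.
Qed.
End EnergyGradient.

Section Geometry.
Variables (R : realType) (d : nat).

Definition borel := g_sigma_algebraType (@open 'rV[R]_d).

(* Lebesgue measure on R^d is the unique Borel measure with these values. *)
Definition is_lebesgue (vol : {measure set borel -> \bar R}) : Prop :=
  forall a b : 'rV[R]_d, (forall i, a 0 i <= b 0 i) ->
    vol [set x : 'rV[R]_d | forall i, a 0 i <= x 0 i <= b 0 i] =
      (\prod_(i < d) (b 0 i - a 0 i))%:E.

(* kappa is tangent at x to the half-space with outward unit normal v. *)
Definition outward_unit_normal (kappa : set 'rV[R]_d) (x v : 'rV[R]_d) : Prop :=
  dot v v = 1 /\
  forall e : R, 0 < e -> \forall z \near x,
    (kappa z -> dot v (z - x) <= e * `|z - x|) /\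
    (~ kappa z -> - (e * `|z - x|) <= dot v (z - x)).

(* The normals are indexed by faces, since at a point shared by several faces
   each face has its own; such points are governed by continuity on the face. *)
Record element := Element {
  kappa : set 'rV[R]_d;
  nfaces : nat;
  face : 'I_nfaces -> set 'rV[R]_d;
  normal : 'I_nfaces -> 'rV[R]_d -> 'rV[R]_d;
  kappa_compact : compact kappa;
  kappa_interior : interior kappa !=set0;
  kappa_regular : closure (interior kappa) = kappa;
  face_boundary : \bigcup_(f in [set: 'I_nfaces]) face f = kappa `\` interior kappa;
  normal_unit : forall f x, face f x -> dot (normal f x) (normal f x) = 1;
  normal_continuous : forall f, {within face f, continuous (normal f)};
  normal_outward : forall f x v, face f x ->
    outward_unit_normal kappa x v -> normal f x = v }.

(* Integration against a signed measure: covers the exact volume and surface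
   integrals as well as quadrature rules with weights of any sign. *)
Record integration := Integration {
  ipos : {measure set borel -> \bar R};
  ineg : {measure set borel -> \bar R} }.

Definition integrate (mu : integration) (D : set 'rV[R]_d) (f : 'rV[R]_d -> R) : R :=
  Rintegral (ipos mu) (D : set borel) f - Rintegral (ineg mu) (D : set borel) f.

Definition integrate_rV (m : nat) (mu : integration) (D : set 'rV[R]_d)
    (f : 'rV[R]_d -> 'rV[R]_m) : 'rV[R]_m :=
  \row_(j < m) integrate mu D (fun x => f x 0 j).

(* Polynomial functions of total degree at most p in d variables. *)
Definition poly_fun (p : nat) (f : 'rV[R]_d -> R) : Prop :=
  exists c : {ffun 'I_d -> 'I_p.+1} -> R, forall x,
    f x = \sum_(a : {ffun 'I_d -> 'I_p.+1} | (\sum_(i < d) a i <= p)%N)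
            c a * \prod_(i < d) x 0 i ^+ a i.

(* phi is a basis of the space P_p(K) of functions on K. *)
Definition is_basis_Pp (K : set 'rV[R]_d) (p nb : nat)
    (phi : 'I_nb -> 'rV[R]_d -> R) : Prop :=
  [/\ forall j, poly_fun p (phi j),
      forall f, poly_fun p f -> exists c : 'I_nb -> R,
        forall x, K x -> f x = \sum_(j < nb) c j * phi j x
    & forall c : 'I_nb -> R,
        (forall x, K x -> \sum_(j < nb) c j * phi j x = 0) -> forall j, c j = 0].

End Geometry.

Section Discretization.
Variables (R : realType) (d ns nb nq : nat) (g : gas_mixture R ns).
Variables (vol : {measure set (borel R d) -> \bar R}) (el : element R d).
Variable phi : 'I_nb -> 'rV[R]_d -> R.
Variables (xq : 'I_nq -> 'rV[R]_d) (omega : 'rV[R]_nq).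
Variables (Ivol : integration R d) (Iface : 'I_(nfaces el) -> integration R d).
Local Notation state := 'rV[R]_(d + 1 + ns).
Local Notation coefs := 'M[R]_(nb, d + 1 + ns).

Definition dg_state (Y : coefs) (x : 'rV[R]_d) : state :=
  \sum_(j < nb) phi j x *: row j Y.

Definition mass_matrix : 'M[R]_nb :=
  \matrix_(i, j) Rintegral vol (kappa el : set (borel R d))
                   (fun x => phi i x * phi j x).

Definition Vq : 'M[R]_(nq, nb) := \matrix_(i, j) phi j (xq i).

Definition quadrature_error (f : 'rV[R]_d -> R) : R :=
  Rintegral vol (kappa el : set (borel R d)) f
  - \sum_(i < nq) omega 0 i * f (xq i).

Definition boundary_integral (f : 'I_(nfaces el) -> 'rV[R]_d -> R) : R :=
  \sum_(i < nfaces el) integrate (Iface i) (face i) (f i).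

Definition boundary_integral_rV
    (f : 'I_(nfaces el) -> 'rV[R]_d -> state) : state :=
  \sum_(i < nfaces el) integrate_rV (Iface i) (face i) (f i).

(* In what follows, at a fixed time, Y contains the coefficients of y on the
   element, and ym f x, lam f x are the neighbor trace and the wave speed
   estimate at the point x of the face f. *)
Variables (lam : 'I_(nfaces el) -> 'rV[R]_d -> R).
Variables (ym : 'I_(nfaces el) -> 'rV[R]_d -> state) (Y : coefs).

Definition uncorrected_residual (k : 'I_nb) : state :=
  boundary_integral_rV (fun f x =>
    phi k x *: numerical_flux g (lam f x) (dg_state Y x) (ym f x) (normal f x))
  - integrate_rV Ivol (kappa el) (fun x =>
      \sum_(l < d) 'D_(delta_mx 0 l) (phi k) x *: flux g (dg_state Y x) l)
  + boundary_integral_rV (fun f x =>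
      phi k x *: nonconservative_jump g (dg_state Y x) (ym f x) (normal f x))
  + integrate_rV Ivol (kappa el) (fun x =>
      phi k x *: nonconservative g (dg_state Y) x).

Definition energy_flux_integral : R :=
  boundary_integral (fun f x =>
    numerical_energy_flux g (lam f x) (dg_state Y x) (ym f x) (normal f x)).

Definition wq : 'M[R]_(nq, d + 1 + ns) :=
  \matrix_(i < nq) energy_gradient g (row i (Vq *m Y)).

Definition what : coefs :=
  invmx mass_matrix *m Vq^T *m diag_mx omega *m wq.

Definition wbar : state := nb%:R^-1 *: \sum_(k < nb) row k what.

Definition alpha_den : R :=
  \sum_(k < nb) dot (row k what - wbar) (row k what - wbar).

Definition alpha : R :=
  (energy_flux_integral
   - \sum_(k < nb) dot (row k what) (uncorrected_residual k)) / alpha_den.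

Definition corrected_residual (k : 'I_nb) : state :=
  uncorrected_residual k + alpha *: (row k what - wbar).

End Discretization.

(* Main.v *)
Require Import Defs.
From HB Require Import structures.
From mathcomp Require Import all_boot all_order all_algebra.
From mathcomp Require Import all_classical all_reals all_analysis.
From mathcomp Require Import measurable_realfun lra.

Set Implicit Arguments.
Unset Strict Implicit.
Unset Printing Implicit Defensive.

Import Order.TTheory GRing.Theory Num.Theory.
Import numFieldNormedType.Exports.

Local Open Scope classical_set_scope.
Local Open Scope ring_scope.

(** Test the semi-discretization with the projected gradient: take the dot
product of its [k]-th equation with the [k]-th coefficient of
[what = M^-1 V^T W wq] and sum over [k].

In the time-derivative term the mass matrix cancels against its inverse, since
it is symmetric; what is left is the quadrature sum of
[w (y (x_i)) . d_t y (x_i)], and by the chain rule each summand is the time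
derivative of the total energy at [x_i] ([projected_testing],
[is_derive_dg_energy]).

In the residual term the mean of the deviations [what_k - wbar] is zero, so
testing the correction [alpha (what_k - wbar)] with [what_k] gives [alpha] times
its own denominator, and the definition of [alpha] turns the tested residual
into the energy flux integral ([sum_dot_deviation], [test_corrected_residual]).

The analytic point is the invertibility of the mass matrix
([mass_matrix_unit]): it is the Gram matrix of the basis in [L^2(kappa)], and a
combination of the basis functions with zero [L^2] norm vanishes on [kappa],
because it is continuous, boxes have positive volume and [kappa] is the
closure of its interior ([ge0_Rintegral_eq0]). *)

(** * Borel sets and continuous functions *)

Section BorelSets.
Variables (R : realType) (d : nat).
Local Notation rV := 'rV[R]_d.

Lemma borel_open (U : set rV) : open U -> measurable (U : set (borel R d)).
Proof. by move=> oU; exact: sub_sigma_algebra. Qed.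

Lemma borel_closed (F : set rV) : closed F -> measurable (F : set (borel R d)).
Proof. by move/closed_openC/borel_open/measurableC; rewrite setCK. Qed.

Lemma borel_compact (K : set rV) : compact K -> measurable (K : set (borel R d)).
Proof.
move=> cK; apply: borel_closed; apply: compact_closed cK.
exact: norm_hausdorff.
Qed.

Lemma continuous_borel (D : set rV) (f : rV -> R) : continuous f ->
  measurable_fun (D : set (borel R d)) (f : borel R d -> R).
Proof.
move=> /continuousP cf mD.
apply: (measurability _ (RGenOpens.measurableE R)) => //.
move=> _ [_ [a [b ->] <-]]; apply: measurableI => //.
by apply: borel_open; apply: cf; exact: interval_open.
Qed.

End BorelSets.

Section Boxes.
Variables (R : realType) (d : nat).
Implicit Types a b x : 'rV[R]_d.

Definition box a b : set 'rV[R]_d := [set x | forall i, a 0 i <= x 0 i <= b 0 i].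

Lemma closed_box a b : closed (box a b).
Proof.
have -> : box a b = \bigcap_(i in [set: 'I_d])
    ((fun x => x 0 i) @^-1` `[a 0 i, b 0 i]).
  apply/seteqP; split=> x /=; first by move=> H i _; rewrite /= in_itv /=.
  by move=> H i; have := H i I; rewrite /= in_itv.
apply: closed_bigI => i _; apply: closed_comp => [x _|]; last exact: interval_closed.
exact: coord_continuous.
Qed.

End Boxes.

Section Continuity.
Variables (R : realType) (T : topologicalType).

Lemma continuous_mul (f g : T -> R) :
  continuous f -> continuous g -> continuous (fun x => f x * g x).
Proof. by move=> cf cg x; exact: (@continuousM _ _ f g x (cf x) (cg x)). Qed.

Lemma continuous_scale (c : R) (f : T -> R) :
  continuous f -> continuous (fun x => c * f x).
Proof. by apply: continuous_mul => x; exact: cvg_cst. Qed.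

Lemma continuous_sum (I : Type) (r : seq I) (P : pred I) (F : I -> T -> R) :
  (forall i, P i -> continuous (F i)) ->
  continuous (fun x => \sum_(i <- r | P i) F i x).
Proof.
apply: (@continuous_big R _ +%R) => //.
by move=> z; apply: cvgD; [exact: cvg_fst|exact: cvg_snd].
Qed.

Lemma continuous_prod (I : Type) (r : seq I) (P : pred I) (F : I -> T -> R) :
  (forall i, P i -> continuous (F i)) ->
  continuous (fun x => \prod_(i <- r | P i) F i x).
Proof. by apply: (@continuous_big R _ *%R); exact: mul_continuous. Qed.

Lemma continuous_exp (n : nat) (f : T -> R) :
  continuous f -> continuous (fun x => f x ^+ n).
Proof.
move=> cf x; apply: (@continuous_comp _ _ _ f (fun s => s ^+ n)); first exact: cf.
exact: exprn_continuous.
Qed.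

Lemma continuous_lincomb n (c : 'I_n -> R) (h : 'I_n -> T -> R) :
  (forall i, continuous (h i)) -> continuous (fun x => \sum_(i < n) c i * h i x).
Proof. by move=> ch; apply: continuous_sum => i _; exact: continuous_scale. Qed.

End Continuity.

(** * Integration of continuous functions over a compact set *)

Section Positivity.
Variables (R : realType) (d : nat) (vol : {measure set (borel R d) -> \bar R}).
Hypothesis hvol : is_lebesgue vol.
Local Notation rV := 'rV[R]_d.

(** A compact set lies in a box, and [is_lebesgue] gives the volume of boxes. *)
Lemma compact_finite_volume (K : set rV) : compact K -> (vol K < +oo)%E.
Proof.
move=> cK; have [M [_ HM]] := compact_bounded cK.
pose b : rV := const_mx (`|M| + 1).
have Mb : M < `|M| + 1 by rewrite ltr_pwDr // ler_norm.
have KB : K `<=` box (- b) b.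
  move=> x /(HM _ Mb) xM i; rewrite /b !mxE -ler_norml.
  apply: le_trans xM; rewrite [leRHS]/Num.norm /= mx_normrE.
  by apply: (le_bigmax _ (fun ij => `|x ij.1 ij.2|) (0, i)).
apply: (@le_lt_trans _ _ (vol (box (- b) b))).
  by apply: le_measure => //; rewrite inE;
    [exact: borel_compact|apply: borel_closed; exact: closed_box].
rewrite hvol ?ltry // => i; rewrite /b !mxE.
by apply: (@le_trans _ _ 0); rewrite ?oppr_le0 addr_ge0.
Qed.

Lemma integrable_continuous (K : set rV) (f : rV -> R) :
  compact K -> continuous f -> vol.-integrable (K : set (borel R d)) (EFin \o f).
Proof.
move=> cK cf; apply: measurable_bounded_integrable.
- exact: borel_compact.
- exact: compact_finite_volume.
- exact: continuous_borel.
- have /compact_bounded [M [Mr HM]] : compact (f @` K).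
    by apply: continuous_compact => //; exact: continuous_subspaceT.
  exists M; split=> // x Mx y Ky; apply: HM => //; by exists y.
Qed.

Lemma Rintegral_lincomb (K : set rV) n (c : 'I_n -> R) (h : 'I_n -> rV -> R) :
  compact K -> (forall i, continuous (h i)) ->
  \sum_(i < n) c i * Rintegral vol (K : set (borel R d)) (h i)
  = Rintegral vol (K : set (borel R d)) (fun x => \sum_(i < n) c i * h i x).
Proof.
move=> cK ch; have mK := borel_compact cK.
elim: n c h ch => [|n IH] c h ch.
  rewrite big_ord0; under [RHS]eq_Rintegral do rewrite big_ord0.
  by rewrite Rintegral_cst // mul0r.
rewrite big_ord_recr /= IH //.
rewrite -RintegralZl //; last exact: integrable_continuous.
rewrite -RintegralD //; first last.
- by apply: integrable_continuous => //; exact: continuous_scale.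
- by apply: integrable_continuous => //; exact: continuous_lincomb.
by apply: eq_Rintegral => x _; rewrite big_ord_recr.
Qed.

(** If [f x > 0] at an interior point [x], then [f] stays above [f x / 2] on a
box of positive volume around [x] inside [K], which makes the integral positive.
Regularity of [K] extends the vanishing from the interior to [K]. *)
Lemma ge0_Rintegral_eq0 (K : set rV) (f : rV -> R) :
  compact K -> closure (interior K) = K -> continuous f -> (forall x, 0 <= f x) ->
  Rintegral vol (K : set (borel R d)) f = 0 -> forall x, K x -> f x = 0.
Proof.
move=> cK rK cf f0 If0.
have fI x : interior K x -> f x = 0.
  move=> Kx; apply/eqP; rewrite eq_le f0 andbT leNgt; apply/negP => fx.
  pose r := f x / 2; have r0 : 0 < r by rewrite divr_gt0.
  have rfx : r < f x by rewrite /r ltr_pdivrMr // mulr_natr mulr2n ltrDl.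
  have : nbhs x (K `&` [set z | r < f z]).
    apply: filterI => //; apply: (cf x [set s | r < s]).
    exact: (lt_nbhsr rfx).
  move=> /nbhs_ballP[e /= e0 He].
  (* Half the radius, so that the closed box fits in the open ball. *)
  pose h : rV := const_mx (e / 2).
  have h0 : 0 < e / 2 by rewrite divr_gt0.
  have He2 z : box (x - h) (x + h) z -> K z /\ r <= f z.
    move=> Bz; suff /He [? /ltW] : ball x e z by [].
    split=> // i j; rewrite ord1; have := Bz j; rewrite /h !mxE /ball /=.
    rewrite distrC => H.
    have : `|z 0 j - x 0 j| <= e / 2 by rewrite ler_distl.
    by move=> /le_lt_trans -> //; rewrite ltr_pdivrMr // mulr_natr mulr2n ltrDl.
  pose B : set (borel R d) := box (x - h) (x + h).
  have mB : measurable B by apply: borel_closed; exact: closed_box.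
  have mK := borel_compact cK.
  have volB : vol B = (e ^+ d)%:E.
    rewrite hvol => [|i]; last first.
      by rewrite /h !mxE lerD2l (le_trans (y := 0)) ?oppr_le0 // ltW.
    rewrite (eq_bigr (fun=> e)) ?prodr_const ?card_ord // => i _.
    by rewrite /h !mxE; lra.
  have : (0 < r%:E * (e ^+ d)%:E)%E by rewrite -EFinM lte_fin mulr_gt0 // exprn_gt0.
  rewrite -volB -integral_cst // ltNge => /negP; apply.
  apply: (@le_trans _ _ (\int[vol]_(z in (K : set (borel R d))) (f z)%:E)%E); last first.
    move: If0; rewrite /Rintegral => /eqP.
    rewrite fine_eq0 ?integrable_fin_num //; first by move=> /eqP ->.
    exact: integrable_continuous.
  apply: (@le_trans _ _ (\int[vol]_(z in B) (f z)%:E)%E).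
    apply: ge0_le_integral => //=.
    - by move=> z _; rewrite lee_fin ltW.
    - by apply/measurable_EFinP; exact: continuous_borel.
    - by move=> z /He2[_]; rewrite lee_fin.
  apply: ge0_subset_integral => //=.
  - by apply/measurable_EFinP; exact: continuous_borel.
  - by move=> z _; rewrite lee_fin.
  - by move=> z /He2[].
move=> x; rewrite -rK => clx; suff : closed (f @^-1` [set s | s = 0]).
  by apply; apply: closure_subset clx => z /fI.
by apply: preimage_closed; [move=> ? _; exact: cf|exact: closed_eq].
Qed.

(** * Invertibility of the mass matrix *)

Lemma poly_fun_continuous p (f : rV -> R) : poly_fun p f -> continuous f.
Proof.
move=> [c /funext ->].
apply: continuous_sum => a _; apply: continuous_scale.
by apply: continuous_prod => i _; apply: continuous_exp; exact: coord_continuous.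
Qed.

(** If [v] is in the kernel of the Gram matrix, then [f = sum_j v_j phi_j] is
orthogonal to every [phi_i], hence to itself, so that [f] vanishes on the element
and the freeness of the basis gives [v = 0]. *)
Lemma mass_matrix_unit (el : element R d) p nb (phi : 'I_nb -> rV -> R) :
  is_basis_Pp (kappa el) p phi -> mass_matrix vol el phi \in unitmx.
Proof.
case=> pphi _ free.
have cphi j : continuous (phi j) by exact: poly_fun_continuous (pphi j).
have cK := @kappa_compact _ _ el.
rewrite -row_free_unit; apply: inj_row_free => v vM0.
pose f x := \sum_(j < nb) v 0 j * phi j x.
have cf : continuous f by exact: continuous_lincomb.
have orth i : Rintegral vol (kappa el : set (borel R d)) (fun x => phi i x * f x) = 0.
  have := congr1 (fun w : 'rV_nb => w 0 i) vM0; rewrite !mxE => <-.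
  under [RHS]eq_bigr do rewrite mxE.
  rewrite Rintegral_lincomb // => [|j]; last first.
    by apply: continuous_mul; exact: cphi.
  apply: eq_Rintegral => x _; rewrite mulr_sumr; apply: eq_bigr => j _.
  by rewrite mulrCA; congr (_ * _); rewrite mulrC.
have If2 : Rintegral vol (kappa el : set (borel R d)) (fun x => f x ^+ 2) = 0.
  transitivity (\sum_(i < nb) v 0 i *
      Rintegral vol (kappa el : set (borel R d)) (fun x => phi i x * f x)).
    rewrite Rintegral_lincomb // => [|j]; last first.
      by apply: continuous_mul; [exact: cphi|exact: cf].
    apply: eq_Rintegral => x _; rewrite expr2 {1}/f mulr_suml.
    by apply: eq_bigr => j _; rewrite mulrA.
  by rewrite big1 // => i _; rewrite orth mulr0.
apply/rowP => j; rewrite mxE; apply: (free (fun j => v 0 j)) => x Kx.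
apply/eqP; rewrite -/(f x) -sqrf_eq0; apply/eqP.
apply: (ge0_Rintegral_eq0 (f := fun x => f x ^+ 2) cK _ _ _ If2) => // [||z].
- exact: kappa_regular.
- exact: continuous_exp.
- exact: sqr_ge0.
Qed.

Lemma mass_matrix_sym (el : element R d) nb (phi : 'I_nb -> rV -> R) :
  (mass_matrix vol el phi)^T = mass_matrix vol el phi.
Proof.
apply/matrixP => i j; rewrite !mxE.
by apply: eq_Rintegral => x _; rewrite mulrC.
Qed.

End Positivity.

(** * Testing with the projected gradient *)

Section DotProduct.
Variables (R : realType) (n : nat).
Implicit Types u v : 'rV[R]_n.

Lemma dotDr u v v' : dot u (v + v') = dot u v + dot u v'.
Proof. by rewrite /dot -big_split; apply: eq_bigr => i _; rewrite mxE mulrDr. Qed.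

Lemma dotZr a u v : dot u (a *: v) = a * dot u v.
Proof. by rewrite /dot mulr_sumr; apply: eq_bigr => i _; rewrite mxE mulrCA. Qed.

Lemma dotBl u u' v : dot (u - u') v = dot u v - dot u' v.
Proof. by rewrite /dot -sumrB; apply: eq_bigr => i _; rewrite !mxE mulrBl. Qed.

Lemma dot_sumr (I : finType) u (v : I -> 'rV[R]_n) :
  dot u (\sum_i v i) = \sum_i dot u (v i).
Proof.
rewrite /dot exchange_big; apply: eq_bigr => i _.
by rewrite summxE mulr_sumr.
Qed.

Lemma sum_dot_row m (A B : 'M[R]_(m, n)) :
  \sum_(k < m) dot (row k A) (row k B) = \tr (A *m B^T).
Proof.
rewrite /mxtrace; apply: eq_bigr => k _; rewrite mxE.
by apply: eq_bigr => j _; rewrite !mxE.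
Qed.

Lemma sum_dot_row_diag m (o : 'rV[R]_m) (A B : 'M[R]_(m, n)) :
  \sum_(k < m) o 0 k * dot (row k A) (row k B) = \tr (diag_mx o *m A *m B^T).
Proof.
rewrite -sum_dot_row; apply: eq_bigr => k _.
rewrite /dot mulr_sumr; apply: eq_bigr => j _.
by rewrite mul_diag_mx !mxE mulrA.
Qed.

(** Deviations from the mean sum to zero, so they are orthogonal to the mean. *)
Lemma sum_dot_deviation m (A : 'M[R]_(m, n)) :
  let mean := m%:R^-1 *: \sum_(k < m) row k A in
  \sum_(k < m) dot (row k A) (row k A - mean)
  = \sum_(k < m) dot (row k A - mean) (row k A - mean).
Proof.
move=> mean; under [RHS]eq_bigr do rewrite dotBl.
rewrite sumrB -dot_sumr sumrB sumr_const card_ord.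
suff -> : \sum_(k < m) row k A = mean *+ m.
  by rewrite subrr -(scale0r (0 : 'rV_n)) dotZr mul0r subr0.
case: m A @mean => [|m] A mean; first by rewrite big_ord0 mulr0n.
by rewrite -scaler_nat /mean scalerA mulfV ?scale1r // pnatr_eq0.
Qed.

End DotProduct.

(** The coefficients of the projection are such that testing a discrete field
with the projection, in the inner product of the mass matrix, is testing its
point values with those of [w], in the inner product of the quadrature rule.
Both sides are traces; [M^T] cancels [M^-1] after a cyclic permutation. *)
Lemma projected_testing (R : realType) nb nq m (M : 'M[R]_nb)
    (V : 'M[R]_(nq, nb)) (o : 'rV[R]_nq) (w : 'M[R]_(nq, m)) (D : 'M[R]_(nb, m)) :
  M \in unitmx -> M^T = M ->
  let what := invmx M *m V^T *m diag_mx o *m w in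
  \sum_(k < nb) dot (row k what) (row k (M *m D))
  = \sum_(i < nq) o 0 i * dot (row i w) (row i (V *m D)).
Proof.
move=> uM sM what; rewrite sum_dot_row sum_dot_row_diag !trmx_mul sM.
rewrite mulmxA mxtrace_mulC !mulmxA mulmxV // mul1mx.
by rewrite [RHS]mxtrace_mulC !mulmxA.
Qed.

Section Discretization.
Variables (R : realType) (d ns nb nq : nat) (g : gas_mixture R ns).
Variable phi : 'I_nb -> 'rV[R]_d -> R.

Lemma dg_stateE (Y : 'M[R]_(nb, d + 1 + ns)) x j :
  dg_state phi Y x 0 j = \sum_(k < nb) phi k x * Y k j.
Proof. by rewrite /dg_state summxE; apply: eq_bigr => k _; rewrite !mxE. Qed.

Lemma row_VqM (xq : 'I_nq -> 'rV[R]_d) (Y : 'M[R]_(nb, d + 1 + ns)) i :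
  row i (Vq phi xq *m Y) = dg_state phi Y (xq i).
Proof.
apply/rowP => j; rewrite dg_stateE !mxE.
by apply: eq_bigr => k _; rewrite mxE.
Qed.

(** The chain rule applies at each fixed point, where the state is a linear
function of the coefficients. *)
Lemma is_derive_dg_energy (yhat : R -> 'M[R]_(nb, d + 1 + ns)) (t : R) x :
  derivable yhat t 1 -> admissible g (dg_state phi (yhat t) x) ->
  is_derive t 1 (fun s => total_energy g (dg_state phi (yhat s) x))
    (dot (energy_gradient g (dg_state phi (yhat t) x))
         (dg_state phi (derive1 yhat t) x)).
Proof.
move=> dy [rho0 S0].
rewrite energy_gradientE ?(gt_eqF rho0) //.
apply: is_derive_total_energy; rewrite ?(gt_eqF rho0) // => j.
have H k : is_derive t 1 (phi k x *: (fun s => yhat s k j))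
    (phi k x *: (derive1 yhat t k j)).
  have : is_derive t 1 (fun s => yhat s k j) (derive1 yhat t k j).
    apply: DeriveDef; first by move/derivable_mxP: dy.
    by rewrite derive1E derive_mx // mxE.
  by move=> ?; apply: is_deriveZ.
have := is_derive_sum H; rewrite dg_stateE; congr (is_derive _ _ _ _).
by apply: funext => s; rewrite fct_sumE dg_stateE.
Qed.

(** The tested correction is [alpha * alpha_den], and [alpha] is the quotient for
which this makes up the difference between the energy flux integral and the
tested uncorrected residual. *)
Lemma test_corrected_residual
    (vol : {measure set (borel R d) -> \bar R}) (el : element R d)
    (xq : 'I_nq -> 'rV[R]_d) (omega : 'rV[R]_nq)
    (Ivol : integration R d) (Iface : 'I_(nfaces el) -> integration R d) lam ym
    (Y : 'M[R]_(nb, d + 1 + ns)) :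
  alpha_den g vol el phi xq omega Y != 0 ->
  \sum_(k < nb) dot (row k (what g vol el phi xq omega Y))
     (corrected_residual g vol phi xq omega Ivol Iface lam ym Y k)
  = energy_flux_integral g phi Iface lam ym Y.
Proof.
move=> den0; rewrite /corrected_residual.
under eq_bigr do rewrite dotDr dotZr.
by rewrite big_split -mulr_sumr /= sum_dot_deviation mulfVK // addrC subrK.
Qed.

End Discretization.

Theorem proposition10 (R : realType) (d ns : nat) (g : gas_mixture R ns)
  (vol : {measure set (borel R d) -> \bar R}) (hvol : is_lebesgue vol)
  (el : element R d)
  (p nb : nat) (phi : 'I_nb -> 'rV[R]_d -> R)
  (hphi : is_basis_Pp (kappa el) p phi)
  (nq : nat) (xq : 'I_nq -> 'rV[R]_d) (omega : 'rV[R]_nq)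
  (hxq : forall i, kappa el (xq i))
  (Ivol : integration R d) (Iface : 'I_(nfaces el) -> integration R d)
  (J : set R) (hJ : open J)
  (yhat : R -> 'M[R]_(nb, d + 1 + ns))
  (ym : R -> 'I_(nfaces el) -> 'rV[R]_d -> 'rV[R]_(d + 1 + ns))
  (lam : R -> 'I_(nfaces el) -> 'rV[R]_d -> R)
  (hyhat : forall t, J t -> derivable yhat t 1)
  (hadm : forall t x, J t -> kappa el x -> admissible g (dg_state phi (yhat t) x))
  (hadm_ym : forall t f x, J t -> face f x -> admissible g (ym t f x))
  (halpha : forall t, J t -> alpha_den g vol el phi xq omega (yhat t) != 0)
  (hode : forall t, J t -> forall k : 'I_nb,
     \sum_(j < nb) mass_matrix vol el phi k j *: row j (derive1 yhat t)
     + corrected_residual g vol phi xq omega Ivol Iface (lam t) (ym t) (yhat t) k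
     = 0) :
  forall t, J t ->
    [/\ forall x, kappa el x ->
          derivable (fun s => total_energy g (dg_state phi (yhat s) x)) t 1,
        \sum_(i < nq) omega 0 i *
          derive1 (fun s => total_energy g (row i (Vq phi xq *m yhat s))) t
        + energy_flux_integral g phi Iface (lam t) (ym t) (yhat t) = 0
      & Rintegral vol (kappa el : set (borel R d))
          (fun x => derive1 (fun s => total_energy g (dg_state phi (yhat s) x)) t)
        + energy_flux_integral g phi Iface (lam t) (ym t) (yhat t)
        = quadrature_error vol el xq omega
            (fun x => derive1 (fun s => total_energy g (dg_state phi (yhat s) x)) t)].

Proof.
have HE t x : J t -> kappa el x ->
    is_derive t 1 (fun s => total_energy g (dg_state phi (yhat s) x))
      (dot (energy_gradient g (dg_state phi (yhat t) x))
           (dg_state phi (derive1 yhat t) x)).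
  by move=> Jt Kx; apply: is_derive_dg_energy; [exact: hyhat|exact: hadm].
move=> t Jt.
have quadE i : derive1 (fun s => total_energy g (row i (Vq phi xq *m yhat s))) t
    = derive1 (fun s => total_energy g (dg_state phi (yhat s) (xq i))) t.
  by congr (derive1 _ t); apply: funext => s; rewrite row_VqM.
have balance : \sum_(i < nq) omega 0 i *
      derive1 (fun s => total_energy g (row i (Vq phi xq *m yhat s))) t
    + energy_flux_integral g phi Iface (lam t) (ym t) (yhat t) = 0.
  (* The middle term tests the equations of the scheme with [wh], so that it
     vanishes, and also splits into the two terms of the balance. *)
  pose wh := what g vol el phi xq omega (yhat t).
  transitivity (\sum_(k < nb) dot (row k wh)
      (row k (mass_matrix vol el phi *m derive1 yhat t)
       + corrected_residual g vol phi xq omega Ivol Iface (lam t) (ym t)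
           (yhat t) k)).
    under [RHS]eq_bigr do rewrite dotDr.
    rewrite big_split /= test_corrected_residual; last exact: halpha.
    rewrite projected_testing; [|exact: mass_matrix_unit hphi|exact: mass_matrix_sym].
    congr (_ + _); apply: eq_bigr => i _; congr (_ * _).
    have [_ dE] := HE t (xq i) Jt (hxq i).
    by rewrite quadE derive1E dE rowK !row_VqM.
  apply: big1 => k _; rewrite row_mul mulmx_sum_row.
  under eq_bigr do rewrite [row k _ _ _]mxE.
  by rewrite hode // -(scale0r (0 : 'rV_(d + 1 + ns))) dotZr mul0r.
split=> //; first by move=> x Kx; have [] := HE t x Jt Kx.
rewrite /quadrature_error; congr (_ + _); apply/eqP; rewrite -addr_eq0 addrC.
by under eq_bigr do rewrite -quadE; rewrite balance.
Qed.
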